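(* Let $m\ge3$ and let $P,Q\in\mathbb C[z_1,\dots,z_m]$ be reduced irreducible homogeneous polynomials of the same degree and in general projective position. If $\Omega$ is a homogeneous polynomial $1$-form on $\mathbb C^m$ such that $\deg\Omega=2\deg P-1$ and both $(P=0)$ and $(Q=0)$ are invariant by $\Omega$, then \[ \frac{\Omega}{PQ}=a\frac{dP}{P}+b\frac{dQ}{Q} \] for some constants $a,b\in\mathbb C$.
   Context: The degree of a homogeneous polynomial $1$-form $\Omega=\sum_j A_j\,dz_j$ is the common degree of its homogeneous coefficients $A_j$. For a reduced polynomial $R$ and a polynomial $1$-form $\Omega$ (not necessarily integrable), the hypersurface $(R=0)$ is invariant by $\Omega$ if $R$ divides $\Omega\wedge dR$. Reduced irreducible homogeneous polynomials $P,Q$ are in general projective position if the projective hypersurfaces $\mathbb P(P=0),\mathbb P(Q=0)\subset\mathbb{CP}^{m-1}$ are smooth and intersect transversely. *)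

(* Defs.v *)
From HB Require Import structures.
From mathcomp Require Import all_boot all_order all_algebra fraction.
From mathcomp Require Import reals complex.
From mathcomp Require Import mpoly.

Set Implicit Arguments.
Unset Strict Implicit.
Unset Printing Implicit Defensive.

Import GRing.Theory.
Local Open Scope ring_scope.

(* A polynomial 1-form \sum_j A_j dz_j on C^m is the row vector of its
   coefficients A_j. *)
Definition form1 (C : fieldType) (m : nat) := 'rV[{mpoly C[m]}]_m.

(* A polynomial 2-form is the matrix whose (i, j) entry, for i < j, is its
   coefficient on dz_i /\ dz_j, extended by antisymmetry. *)
Definition form2 (C : fieldType) (m : nat) := 'M[{mpoly C[m]}]_m.

Definition dform (C : fieldType) (m : nat) (p : {mpoly C[m]}) : form1 C m :=
  \row_j p^`M(j).

Definition wedge (C : fieldType) (m : nat) (w1 w2 : form1 C m) : form2 C m :=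
  \matrix_(i, j) (w1 0 i * w2 0 j - w1 0 j * w2 0 i).

Definition homog_form (C : fieldType) (m : nat) (d : nat) (w : form1 C m)
  : Prop := forall j, w 0 j \is d.-homog.

Definition reduced_mpoly (C : fieldType) (m : nat) (p : {mpoly C[m]}) : Prop :=
  p != 0 /\
  forall f g : {mpoly C[m]}, p = f ^+ 2 * g -> f \is a GRing.unit.

Definition irreducible_mpoly (C : fieldType) (m : nat) (p : {mpoly C[m]})
  : Prop :=
  [/\ p != 0, p \isn't a GRing.unit &
      forall f g : {mpoly C[m]}, p = f * g ->
        f \is a GRing.unit \/ g \is a GRing.unit].

(* r divides the 2-form w /\ dr; meant for r reduced. *)
Definition invariant_by (C : fieldType) (m : nat) (r : {mpoly C[m]})
    (w : form1 C m) : Prop :=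
  exists theta : form2 C m, wedge w (dform r) = r *: theta.

Definition eval_form (C : fieldType) (m : nat) (w : form1 C m) (z : 'rV[C]_m)
  : 'rV[C]_m := map_mx (meval (z 0)) w.

(* The points of CP^(m-1) are represented by nonzero vectors z of C^m; for p
   homogeneous, whether p or dp vanishes at z depends only on the line C z. *)
Definition on_hypersurface (C : fieldType) (m : nat) (p : {mpoly C[m]})
    (z : 'rV[C]_m) : Prop := z != 0 /\ p.@[z 0] = 0.

(* Jacobian criterion: meant for p reduced and homogeneous, so that p generates
   the ideal of the hypersurface. *)
Definition smooth_hypersurface (C : fieldType) (m : nat) (p : {mpoly C[m]})
  : Prop :=
  forall z : 'rV[C]_m, on_hypersurface p z -> eval_form (dform p) z != 0.

(* The row space of this matrix is ker dp(z), the subspace of C^m that contains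
   the line C z and whose quotient by it is the tangent space at [z] of the
   hypersurface (p = 0) of CP^(m-1), inside T_[z] CP^(m-1) = C^m / C z (up to
   the choice of z in its line). *)
Definition lifted_tangent (C : fieldType) (m : nat) (p : {mpoly C[m]})
    (z : 'rV[C]_m) : 'M[C]_m := kermx (eval_form (dform p) z)^T.

(* The tangent spaces at [z] span C^m / C z if and only if their preimages in
   C^m, which both contain z, span C^m. *)
Definition transverse_hypersurfaces (C : fieldType) (m : nat)
    (p q : {mpoly C[m]}) : Prop :=
  forall z : 'rV[C]_m, on_hypersurface p z -> on_hypersurface q z ->
    row_full (lifted_tangent p z + lifted_tangent q z)%MS.

Definition general_projective_position (C : fieldType) (m : nat)
    (p q : {mpoly C[m]}) : Prop :=
  [/\ smooth_hypersurface p, smooth_hypersurface q &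
      transverse_hypersurfaces p q].

(* w seen as a rational 1-form, with coefficients in C(z_1, ..., z_m). *)
Definition ratform (C : fieldType) (m : nat) (w : form1 C m)
  : 'rV[{fraction {mpoly C[m]}}]_m :=
  map_mx (@tofrac {mpoly C[m]}) w.

Definition ratpoly (C : fieldType) (m : nat) (p : {mpoly C[m]})
  : {fraction {mpoly C[m]}} := tofrac p.

Definition ratconst (C : fieldType) (m : nat) (c : C)
  : {fraction {mpoly C[m]}} := tofrac (c%:MP_[m]).

(* Main.v *)
Require Import Defs.
From mathcomp Require Import all_boot all_order all_algebra fraction.
From mathcomp Require Import reals complex.
From mathcomp Require Import mpoly.
From mathcomp Require Import ring zify.

Set Implicit Arguments.
Unset Strict Implicit.
Unset Printing Implicit Defensive.

Import Order.TTheory GRing.Theory Num.Theory.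
Local Open Scope ring_scope.

(** Along the cone (P = 0) the form Omega is a multiple f dP of dP: it is
    proportional to dP, which vanishes at most at the origin, and a function
    defined on this cone outside the origin extends across it, because the cone
    has dimension at least two.  Hence Omega = f dP + P alpha (division_mod).
    Where P = Q = 0, Omega is proportional to both dP and dQ, which are
    independent there by transversality; so f vanishes there, and
    f = v Q + w P.  Then Omega = v Q dP + P alpha', and dividing alpha' by dQ
    modulo Q in the same way gives
      Omega = v Q dP + g P dQ + P Q beta.
    In degree 2 deg P - 1 only the constant terms of v and g contribute, and
    beta disappears, since P Q already has degree 2 deg P
    (logarithmic_form).

    Extension across the origin is made algebraic as follows.  A projective
    Nullstellensatz (projective_nullstellensatz) turns each geometric
    hypothesis, namely that P, or Q, has no singular point and that the two
    hypersurfaces are tangent nowhere, into the membership of some powers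
    z_i^N in the ideal of the corresponding equations.  So the division by dP
    and the membership of f in (P, Q) hold after multiplication by z_i^N, for
    every i, and it remains to divide by these powers.  Exactness of the Koszul
    complex of z_0^N, z_1^N, z_2^N does that (divides_lift,
    in_ideal2_of_mul): this is where three variables are required.

    One more fact is used: P is not a zero divisor modulo Q.  It comes from
    transversality again (divides_cancel_transverse).  If Q divides b P,
    differentiation along the vector fields tangent to (Q = 0) shows that Q
    divides b^2 up to powers of the z_i, hence that Q divides b^2.  Further
    differentiation shows that b b^k is divisible by Q^k for every k, so that
    b / Q is almost integral over the polynomial ring, which is completely
    integrally closed: Q divides b. *)

(** * Divisibility *)

Definition divides (A : comNzRingType) (p q : A) := exists r, q = p * r.

Section Divisibility.
Variable A : comNzRingType.
Implicit Types p q r : A.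

Lemma divides_refl p : divides p p. Proof. by exists 1; rewrite mulr1. Qed.
Lemma divides0 p : divides p 0. Proof. by exists 0; rewrite mulr0. Qed.
Lemma divides_add p q r : divides p q -> divides p r -> divides p (q + r).
Proof. by move=> [a ->] [b ->]; exists (a + b); rewrite mulrDr. Qed.
Lemma divides_mull p q r : divides p q -> divides p (r * q).
Proof. by move=> [a ->]; exists (r * a); rewrite mulrCA. Qed.
Lemma divides_mulr p q r : divides p q -> divides p (q * r).
Proof. by rewrite mulrC; exact: divides_mull. Qed.
Lemma divides_opp p q : divides p q -> divides p (- q).
Proof. by rewrite -mulN1r; exact: divides_mull. Qed.
Lemma divides_sub p q r : divides p q -> divides p r -> divides p (q - r).
Proof. by move=> pq pr; apply/divides_add/divides_opp. Qed.
Lemma divides_sum (I : finType) p (F : I -> A) :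
  (forall i, divides p (F i)) -> divides p (\sum_i F i).
Proof.
by move=> pF; apply: big_ind => //; [exact: divides0 | exact: divides_add].
Qed.

End Divisibility.

(** * Koszul exactness and division by powers of variables *)

Section Koszul.
Variables (A : idomainType) (x y z : A).

Definition koszul2_exact (x y : A) :=
  forall u v, x * u = y * v -> exists w, u = y * w /\ v = x * w.

Definition koszul3_exact := forall a b c, x * a + y * b + z * c = 0 ->
  exists g0 g1 g2,
    [/\ a = y * g2 - z * g1, b = z * g0 - x * g2 & c = x * g1 - y * g0].

Hypotheses (x0 : x != 0) (y0 : y != 0).
Hypothesis xy_exact : koszul2_exact x y.

(** A class modulo p that both x and y kill is zero: with x u = p a and
    y u = p b, the relation x b = y a forces x to divide a. *)
Lemma divides_of_mul (p u : A) :
  p != 0 -> divides p (x * u) -> divides p (y * u) -> divides p u.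
Proof.
move=> p0 [a ua] [b ub].
have /xy_exact[w [_ aw]] : x * b = y * a.
  by apply: (mulfI p0); rewrite mulrCA -ub mulrCA ua; ring.
by exists w; apply: (mulfI x0); rewrite ua aw mulrCA.
Qed.

Hypothesis xyz_exact : koszul3_exact.

(** If the fractions f0 / x, f1 / y, f2 / z agree modulo p, then they are one
    polynomial f modulo p.  The defects of agreement, divided by p, form a
    1-cocycle of the Koszul complex of x, y, z; correcting each f_i by a
    multiple of p, as a primitive of this cocycle prescribes, makes the
    fractions agree exactly. *)
Lemma divides_lift (p f0 f1 f2 : A) : p != 0 ->
    divides p (x * f1 - y * f0) -> divides p (y * f2 - z * f1) ->
    divides p (z * f0 - x * f2) ->
  exists f, [/\ divides p (f0 - x * f), divides p (f1 - y * f) &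
    divides p (f2 - z * f)].
Proof.
move=> p0 [h01 e01] [h12 e12] [h20 e20].
have /xyz_exact[g0 [g1 [g2 [h12E h20E h01E]]]] :
    x * h12 + y * h20 + z * h01 = 0.
  apply: (mulfI p0); rewrite mulr0 !mulrDr !(mulrCA p) -e01 -e12 -e20; ring.
have /xy_exact[f [f1E f0E]] : x * (f1 - p * g1) = y * (f0 - p * g0).
  apply/eqP; rewrite -subr_eq0; apply/eqP.
  transitivity (x * f1 - y * f0 - p * (x * g1 - y * g0)); first by ring.
  by rewrite -h01E e01 subrr.
exists f; split.
- by exists g0; rewrite -f0E; ring.
- by exists g1; rewrite -f1E; ring.
exists g2; apply: (mulfI y0).
have -> : y * (f2 - z * f) = (y * f2 - z * f1) + z * (f1 - y * f) by ring.
by rewrite e12 h12E -f1E; ring.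
Qed.

Definition in_ideal2 (p q u : A) := exists a b, u = a * p + b * q.

(** The coefficients of p in the three memberships satisfy the hypotheses of
    divides_lift modulo q, since p can be cancelled there; so they come from a
    single coefficient a, and u - a p is then a class modulo q killed by x and
    y. *)
Lemma in_ideal2_of_mul (p q u : A) : q != 0 ->
    (forall w, divides q (w * p) -> divides q w) ->
    in_ideal2 p q (x * u) -> in_ideal2 p q (y * u) -> in_ideal2 p q (z * u) ->
  in_ideal2 p q u.
Proof.
move=> q0 qp [a0 [b0 e0]] [a1 [b1 e1]] [a2 [b2 e2]].
have [||| a [d0 d1 _]] := @divides_lift q a0 a1 a2 q0.
- apply: qp; exists (y * b0 - x * b1).
  have -> : (x * a1 - y * a0) * p = x * (a1 * p) - y * (a0 * p) by ring.
  have -> : a1 * p = y * u - b1 * q by rewrite e1; ring.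
  have -> : a0 * p = x * u - b0 * q by rewrite e0; ring.
  by ring.
- apply: qp; exists (z * b1 - y * b2).
  have -> : (y * a2 - z * a1) * p = y * (a2 * p) - z * (a1 * p) by ring.
  have -> : a1 * p = y * u - b1 * q by rewrite e1; ring.
  have -> : a2 * p = z * u - b2 * q by rewrite e2; ring.
  by ring.
- apply: qp; exists (x * b2 - z * b0).
  have -> : (z * a0 - x * a2) * p = z * (a0 * p) - x * (a2 * p) by ring.
  have -> : a0 * p = x * u - b0 * q by rewrite e0; ring.
  have -> : a2 * p = z * u - b2 * q by rewrite e2; ring.
  by ring.
have [b ub] : divides q (u - a * p).
  apply: divides_of_mul => //.
  - have -> : x * (u - a * p) = (a0 - x * a) * p + q * b0.
      by rewrite mulrBr e0; ring.
    by apply: divides_add; [apply: divides_mulr | exists b0].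
  - have -> : y * (u - a * p) = (a1 - y * a) * p + q * b1.
      by rewrite mulrBr e1; ring.
    by apply: divides_add; [apply: divides_mulr | exists b1].
by exists a, b; rewrite (mulrC b) -ub; ring.
Qed.

End Koszul.

Section MonomialKoszul.
Variables (R : idomainType) (n N : nat).
Implicit Types (p q : {mpoly R[n]}) (i j k : 'I_n).

Local Notation x i := ('X_i ^+ N : {mpoly R[n]}).

(** The normal forms modulo the N-th power of the i-th variable. *)
Definition low_degree i p := forall m : 'X_{1..n}, (N <= m i)%N -> p@_m = 0.

Lemma low_degreeB i p q :
  low_degree i p -> low_degree i q -> low_degree i (p - q).
Proof. by move=> lp lq m Nm; rewrite mcoeffB lp // lq // subrr. Qed.

Lemma varXE i : x i = 'X_[U_(i) *+ N]. Proof. by rewrite mpolyXn. Qed.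

Lemma varX_neq0 i : x i != 0.
Proof. by rewrite varXE -msupp_eq0 msuppX. Qed.

Lemma mcoeff_varXM i p (m : 'X_{1..n}) :
  (x i * p)@_m = if (N <= m i)%N then p@_(m - U_(i) *+ N) else 0.
Proof.
rewrite varXE mulrC; case: ifP => Nm.
  have le : (U_(i) *+ N <= m)%MM.
    apply/mnm_lepP => j; rewrite mulmnE mnm1E; case: eqP => [<-|_].
      by rewrite mul1n.
    by rewrite mul0n.
  by rewrite -{1}(submK le) addmC mcoeffMX.
apply: memN_msupp_eq0; rewrite (perm_mem (msuppMX _ _)).
apply/mapP => -[m' _ mE]; move: Nm; rewrite mE mnmDE mulmnE mnm1E eqxx mul1n.
by rewrite leq_addr.
Qed.

Lemma low_degree_varXM i j p :
  i != j -> low_degree i p -> low_degree i (x j * p).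
Proof.
move=> ij lp m Nm; rewrite mcoeff_varXM; case: ifP => // _; apply: lp.
by rewrite mnmBE mulmnE mnm1E eq_sym (negPf ij) mul0n subn0.
Qed.

Lemma low_degree_varXM_eq0 i p : low_degree i (x i * p) -> p = 0.
Proof.
move=> lp; apply/mpolyP => m; rewrite mcoeff0.
have := lp (U_(i) *+ N + m)%MM; rewrite mcoeff_varXM.
rewrite !mnmDE !mulmnE mnm1E eqxx mul1n leq_addr addmC addmK.
by apply.
Qed.

Lemma low_degree_decomp i p : exists q r, [/\ p = x i * q + r, low_degree i r &
  forall j, low_degree j p -> low_degree j r].
Proof.
pose r := \sum_(m <- msupp p | ~~ (N <= m i)%N) p@_m *: 'X_[m].
have rE (m : 'X_{1..n}) : r@_m = if (N <= m i)%N then 0 else p@_m.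
  have [mp|mp] := boolP (m \in msupp p); last first.
    rewrite (memN_msupp_eq0 mp) if_same raddf_sum /= big_seq_cond big1 //.
    move=> m' /andP[m'p _]; rewrite mcoeffZ mcoeffX.
    by case: eqP => [e|]; rewrite ?mulr0 // -e m'p in mp *.
  rewrite raddf_sum /= -big_filter; case: ifP => Nm.
    rewrite big_seq big1 // => m'; rewrite mem_filter => /andP[Nm' _].
    rewrite mcoeffZ mcoeffX; case: eqP => [e|]; rewrite ?mulr0 //.
    by rewrite e Nm in Nm'.
  rewrite (bigD1_seq m) ?filter_uniq ?msupp_uniq ?mem_filter ?Nm //=.
  rewrite mcoeffZ mcoeffX eqxx mulr1 big1 ?addr0 // => m' m'm.
  by rewrite mcoeffZ mcoeffX (negPf m'm) mulr0.
exists (\sum_(m <- msupp p | (N <= m i)%N) p@_m *: 'X_[m - U_(i) *+ N]), r.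
split.
- rewrite {1}(mpolyE p) (bigID (fun m : 'X_{1..n} => (N <= m i)%N)) /=.
  congr (_ + _).
  rewrite mulr_sumr; apply: eq_bigr => m Nm.
  rewrite -scalerAr varXE -mpolyXD addmC submK //.
  apply/mnm_lepP => j; rewrite mulmnE mnm1E; case: eqP => [<-|_].
    by rewrite mul1n.
  by rewrite mul0n.
- by move=> m Nm; rewrite rE Nm.
- by move=> j lj m Nm; rewrite rE lj // if_same.
Qed.

Lemma koszul2_var i j : i != j -> koszul2_exact (x i) (x j).
Proof.
move=> ij u v e; have [q [r [vE lr _]]] := low_degree_decomp i v.
have xN0 k : x k != 0 by exact: varX_neq0.
exists q; have r0 : r = 0.
  have : u - x j * q = 0.
    apply: (@low_degree_varXM_eq0 i); have -> : x i * (u - x j * q) = x j * r.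
      by rewrite mulrBr e vE; ring.
    exact: low_degree_varXM.
  move/eqP; rewrite subr_eq0 => /eqP uE; apply: (mulfI (xN0 j)).
  move: e; rewrite uE vE mulrDr mulr0 mulrCA => /eqP.
  by rewrite -subr_eq0 opprD addrA subrr sub0r oppr_eq0 => /eqP.
split; last by rewrite vE r0 addr0.
by apply: (mulfI (xN0 i)); rewrite e vE r0 addr0 mulrCA.
Qed.

(** Take normal forms of c with respect to the first two variables.  What is
    left, r1, satisfies a relation in which the other two terms can be taken
    out one after the other, as multiplying by one variable preserves normality
    with respect to another; hence r1 = 0. *)
Lemma koszul3_var i j k : i != j -> i != k -> j != k ->
  koszul3_exact (x i) (x j) (x k).
Proof.
move=> ij ik jk a b c e.
have xN0 l : x l != 0 by exact: varX_neq0.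
have [q0 [r0 [cE lr0 _]]] := low_degree_decomp i c.
have [q1 [r1 [r0E lr1 lr1']]] := low_degree_decomp j r0.
have li1 : low_degree i r1 by apply: lr1'.
have [q [s [bE ls _]]] := low_degree_decomp i (b + x k * q1).
have aE : a + x k * q0 + x j * q = 0.
  apply: (@low_degree_varXM_eq0 i).
  have -> : x i * (a + x k * q0 + x j * q) = - (x k * r1) - x j * s.
    apply/eqP; rewrite -subr_eq0; apply/eqP; rewrite -e cE r0E.
    have -> : b = x i * q + s - x k * q1 by rewrite -bE; ring.
    by ring.
  apply: low_degreeB; last exact: low_degree_varXM.
  rewrite -mulrN; apply: low_degree_varXM => // m Nm.
  by rewrite mcoeffN li1 ?oppr0.
have sE : x j * - s = x k * r1.
  apply/eqP; rewrite -subr_eq0; apply/eqP; rewrite -[RHS]oppr0 -{1}e.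
  have -> : a = - x k * q0 - x j * q.
    by apply/eqP; rewrite -subr_eq0 -aE; apply/eqP; ring.
  have -> : b = x i * q + s - x k * q1 by rewrite -bE; ring.
  by rewrite cE r0E; ring.
have s0 : - s = 0.
  by apply: (@low_degree_varXM_eq0 j); rewrite sE; apply: low_degree_varXM.
have r10 : r1 = 0 by apply: (mulfI (xN0 k)); rewrite mulr0 -sE s0 mulr0.
exists (- q1), q0, (- q); split.
- by apply/eqP; rewrite -subr_eq0 -aE; apply/eqP; ring.
- have -> : b = x i * q + s - x k * q1 by rewrite -bE; ring.
  by rewrite -[s]opprK s0; ring.
- by rewrite cE r0E r10; ring.
Qed.

End MonomialKoszul.

(** * Complete integral closedness of polynomial rings *)

Section AlmostIntegral.
Variables (F : fieldType) (n : nat).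
Implicit Types (p b c : {mpoly F[n]}).

Lemma mlead_cancel p b : p != 0 -> b != 0 -> (mlead p <= mlead b)%MM ->
  exists s, b - s * p = 0 \/ (mlead (b - s * p) < mlead b)%O.
Proof.
move=> p0 b0 le.
pose s := (mleadc b / mleadc p) *: 'X_[mlead b - mlead p] : {mpoly F[n]}.
have lcp0 : mleadc p != 0 by rewrite mleadc_eq0.
have lcb0 : mleadc b != 0 by rewrite mleadc_eq0.
have s0 : s != 0.
  by rewrite mscalerI negb_or mulf_neq0 ?invr_eq0 //= -msupp_eq0 msuppX.
have ls : mlead (s * p) = mlead b.
  by rewrite mleadM // mleadZ ?mulf_neq0 ?invr_eq0 // mleadXm submK.
exists s; have [|d0] := eqVneq (b - s * p) 0; [by left | right].
rewrite lt_neqAle; apply/andP; split; last first.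
  by apply: le_trans (mleadB_le _ _) _; rewrite ls joinxx.
apply: contra_neq d0 => e; apply/eqP; rewrite -mleadc_eq0 e mcoeffB.
suff -> : (s * p)@_(mlead b) = mleadc b by rewrite subrr.
rewrite -ls mleadM // mleadcM mleadcZE mleadXm mcoeffX eqxx mulr1.
by rewrite -mleadM // ls divfK.
Qed.

(** Comparing leading monomials, k lm(p) <= lm(c) + k lm(b) in each exponent
    and for all k, which forces lm(p) to divide lm(b).  Subtracting from b a
    multiple of p that cancels its leading term preserves the hypothesis, by
    the binomial formula, so induction on the leading monomial concludes. *)
Lemma divides_of_almost_integral p b c : p != 0 -> c != 0 ->
  (forall k, divides (p ^+ k) (c * b ^+ k)) -> divides p b.
Proof.
move=> p0 c0; move: {2}(mlead b) (erefl (mlead b)) => m.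
elim/(@ltmwf n): m b => m IH b mE ai.
have [->|b0] := eqVneq b 0; first exact: divides0.
have le : (mlead p <= mlead b)%MM.
  apply/mnm_lepP => i; rewrite leqNgt; apply/negP => lt.
  (* One more than the exponent in lm(c) is enough to exceed it. *)
  have [e eE] := ai (mlead c i).+1.
  have e0 : e != 0.
    apply: contraNneq (mulf_neq0 c0 (expf_neq0 (mlead c i).+1 b0)) => e0.
    by rewrite eE e0 mulr0.
  have := congr1 (fun q => mlead q i) eE.
  rewrite !mleadM ?expf_neq0 // !mleadX // !mnmDE !mulmnE.
  move: (mlead e i) (mlead c i) (mlead b i) (mlead p i) lt => u v w t lt.
  nia.
have [s [bs|lt]] := mlead_cancel p0 b0 le.
  by exists s; apply/eqP; rewrite mulrC -subr_eq0 bs.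
rewrite mE in lt; have [k|] := IH _ lt _ erefl.
  rewrite exprBn mulr_sumr; apply: divides_sum => i.
  have [e eE] := ai (k - i)%N.
  rewrite -mulr_natl mulrCA; apply: divides_mull.
  exists ((-1) ^+ i * e * s ^+ i).
  have -> : p ^+ k = p ^+ (k - i) * p ^+ i by rewrite -exprD subnK // -ltnS.
  rewrite exprMn.
  transitivity ((-1) ^+ i * s ^+ i * p ^+ i * (c * b ^+ (k - i))).
    by ring.
  by rewrite eE; ring.
move=> r rE; exists (r + s); rewrite mulrDr -rE; ring.
Qed.

End AlmostIntegral.

(** * Nonzerodivisors modulo a smooth hypersurface *)

Section SmoothReduced.
Variables (F : numFieldType) (n : nat) (p : {mpoly F[n]}).
Hypothesis p0 : p != 0.
(** Smoothness in the form in which it is used: the partial derivatives of p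
    have no common zero on the cone (p = 0) but the origin, and a class
    supported at the origin is zero. *)
Hypothesis p_smooth :
  forall u, (forall i, divides p (u * p^`M(i))) -> divides p u.

Lemma mderivXn i (b : {mpoly F[n]}) k :
  (b ^+ k.+1)^`M(i) = k.+1%:R * b ^+ k * b^`M(i).
Proof.
elim: k => [|k IH]; first by rewrite expr0 mulr1 mul1r expr1.
by rewrite exprS mderivM IH -[k.+2%:R]natr1 !exprS; ring.
Qed.

Lemma divides_natM k (u : {mpoly F[n]}) :
  divides p (k.+1%:R * u) -> divides p u.
Proof.
move=> [r e]; exists ((k.+1%:R^-1 : F)%:MP * r).
rewrite mulrCA -e mulrA -mpolyC_nat -mpolyCM mulVf ?mpolyC1 ?mul1r //.
by rewrite pnatr_eq0.
Qed.

(** A smooth hypersurface is reduced.  From b^2 = p e_1 one builds polynomials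
    with b^(k+1) = p^k e_k and b e_k = p e_(k+1): the derivative of the first
    equality at k + 1, multiplied by b, shows that p divides
    b e_(k+1) dp.  So b / p is almost integral. *)
Lemma divides_of_sqr b : divides p (b ^+ 2) -> divides p b.
Proof.
have [->|b0] := eqVneq b 0; first by move=> _; exact: divides0.
move=> [e1 b2E].
have chain k : exists e e', b ^+ k.+1 = p ^+ k * e /\ b * e = p * e'.
  elim: k => [|k [e [e' [bE eE]]]].
    by exists b, e1; rewrite expr1 mul1r -expr2.
  have bE' : b ^+ k.+2 = p ^+ k.+1 * e'.
    by rewrite exprS bE mulrCA eE mulrA -exprSr.
  suff [e'' e''E] : divides p (b * e') by exists e', e''.
  apply: p_smooth => i; apply: (@divides_natM k).
  exists (k.+2%:R * e' * b^`M(i) - b * e'^`M(i)).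
  have := congr1 (mderiv i) bE'.
  rewrite mderivXn bE mderivM mderivXn => d.
  have {}d : p ^+ k * (k.+2%:R * e * b^`M(i)) =
             p ^+ k * (k.+1%:R * p^`M(i) * e' + p * e'^`M(i)).
    rewrite [p ^+ k.+1]exprS in d.
    transitivity (k.+2%:R * (p ^+ k * e) * b^`M(i)); first by ring.
    by rewrite d; ring.
  have {}d := mulfI (expf_neq0 k p0) d.
  have {}d := congr1 (fun t => b * t) d.
  rewrite mulrBr; apply/eqP; rewrite -subr_eq0; apply/eqP.
  transitivity (b * (k.+1%:R * p^`M(i) * e' + p * e'^`M(i)) -
    k.+2%:R * (p * e') * b^`M(i)); first by ring.
  by rewrite -d -eE; ring.
apply: (@divides_of_almost_integral F n p b b) => // k.
by have [e [_ [bE _]]] := chain k; exists e; rewrite -exprS.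
Qed.

(** Let b q = p a, and let X be the derivation with X p = 0 that maps q to a
    minor of (dp, dq).  Then X b * q + b * X q = p * X a, and multiplying by b
    gives that p divides b^2 X q.  As p also divides b^2 q, transversality
    yields that p divides b^2. *)
Lemma divides_cancel_transverse q b :
    (forall u, divides p (u * q) ->
       (forall i j, divides p (u * (p^`M(i) * q^`M(j) - p^`M(j) * q^`M(i)))) ->
     divides p u) ->
  divides p (b * q) -> divides p b.
Proof.
move=> pq_transverse [a bqE]; apply: divides_of_sqr; apply: pq_transverse.
  by exists (b * a); rewrite expr2 -mulrA bqE; ring.
move=> i j; pose X u := p^`M(i) * u^`M(j) - p^`M(j) * u^`M(i).
have : X (b * q) = X (p * a) by rewrite bqE.
rewrite /X !mderivM => e.
have {}e : b * (p^`M(i) * q^`M(j) - p^`M(j) * q^`M(i)) =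
   p * X a - q * X b.
  apply/eqP; rewrite -subr_eq0; apply/eqP.
  move/eqP: e; rewrite -subr_eq0 => /eqP; rewrite /X => <-; ring.
rewrite expr2 -mulrA e; exists (b * X a - a * X b).
by rewrite [RHS]mulrBr [p * (a * _)]mulrA -bqE; ring.
Qed.

End SmoothReduced.

(** * Separating the last variable *)

Section LastVariable.
Variables (R : comNzRingType) (n : nat).
Implicit Types (p : {mpoly R[n.+1]}) (q : {poly {mpoly R[n]}}) (a : 'I_n -> R).

Local Notation widen := (widen_ord (leqnSn n)).

Lemma lift_ord_max (j : 'I_n) : lift ord_max j = widen j.
Proof. by apply/val_inj; rewrite /= /bump leqNgt ltn_ord. Qed.

Lemma ord_max_neq_widen (j : 'I_n) : (ord_max == widen j) = false.
Proof. by rewrite -lift_ord_max (negPf (neq_lift _ _)). Qed.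

(** The inverse of muni, written as an evaluation so that it is
    multiplicative by construction. *)
Definition mpoly_of_poly q : {mpoly R[n.+1]} := (mpwiden q).['X_ord_max].

Lemma mpoly_of_polyD q1 q2 :
  mpoly_of_poly (q1 + q2) = mpoly_of_poly q1 + mpoly_of_poly q2.
Proof. by rewrite /mpoly_of_poly rmorphD hornerD. Qed.

Lemma mpoly_of_polyM q1 q2 :
  mpoly_of_poly (q1 * q2) = mpoly_of_poly q1 * mpoly_of_poly q2.
Proof. by rewrite /mpoly_of_poly rmorphM hornerM. Qed.

Lemma mpoly_of_polyC (c : {mpoly R[n]}) : mpoly_of_poly c%:P = mwiden c.
Proof. by rewrite /mpoly_of_poly mpwidenC hornerC. Qed.

Lemma mpoly_of_polyX : mpoly_of_poly 'X = 'X_ord_max.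
Proof. by rewrite /mpoly_of_poly mpwidenX hornerX. Qed.

Lemma mnm_split (m : 'X_{1..n.+1}) :
  m = (mnmwiden [multinom m (widen i) | i < n] + U_(ord_max) *+ m ord_max)%MM.
Proof.
apply/mnmP => i; rewrite mnmDE mulmnE mnm1E.
case: (unliftP ord_max i) => [j ->|->].
  by rewrite lift_ord_max mnmwiden_widen mnmE ord_max_neq_widen mul0n addn0.
by rewrite mnmwiden_ordmax eqxx mul1n.
Qed.

Lemma muniK p : mpoly_of_poly (muni p) = p.
Proof.
rewrite muniE {3}(mpolyE p) /mpoly_of_poly rmorph_sum /= horner_sum.
apply: eq_bigr => m _.
rewrite !mpwidenZ !mwidenZ !hornerZ -scalerAl; congr (_ *: _).
rewrite mwidenX /mpwiden rmorphXn /= map_polyX hornerXn.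
by rewrite [in RHS](mnm_split m) mpolyXD mpolyXn.
Qed.

Definition extend_point (a : 'I_n -> R) (t : R) (i : 'I_n.+1) : R :=
  if unlift ord_max i is Some j then a j else t.

Lemma extend_point_max a t : extend_point a t ord_max = t.
Proof. by rewrite /extend_point unlift_none. Qed.

Lemma extend_point_widen a t j : extend_point a t (widen j) = a j.
Proof. by rewrite -lift_ord_max /extend_point liftK. Qed.

Lemma meval_mwiden a t (c : {mpoly R[n]}) :
  (mwiden c).@[extend_point a t] = c.@[a].
Proof.
elim/mpolyind: c => [|c m p _ _ IH]; first by rewrite mwiden0 !meval0.
rewrite mwidenD mwidenZ mwidenX !mevalD !mevalZ IH; congr (_ * _ + _).
rewrite !mevalX big_ord_recr /= mnmwiden_ordmax expr0 mulr1.
by apply: eq_bigr => i _; rewrite mnmwiden_widen extend_point_widen.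
Qed.

Lemma meval_mpoly_of_poly a t q :
  (mpoly_of_poly q).@[extend_point a t] = (map_poly (meval a) q).[t].
Proof.
elim/poly_ind: q => [|q c IH].
  by rewrite -(muni0 n R) muniK muni0 meval0 rmorph0 horner0.
rewrite mpoly_of_polyD mpoly_of_polyM mpoly_of_polyX mpoly_of_polyC.
rewrite mevalD mevalM mevalXU IH extend_point_max meval_mwiden.
by rewrite rmorphD rmorphM /= map_polyX map_polyC hornerMXaddC.
Qed.

Lemma meval_muni a t p :
  p.@[extend_point a t] = (map_poly (meval a) (muni p)).[t].
Proof. by rewrite -meval_mpoly_of_poly muniK. Qed.

Lemma coef_muni p k (m : 'X_{1..n}) :
  (muni p)`_k@_m = p@_(mnmwiden m + U_(ord_max) *+ k)%MM.
Proof.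
elim/mpolyind: p => [|c m' p _ _ IH]; first by rewrite muni0 coef0 !mcoeff0.
rewrite muniD muniZ coefD !mcoeffD IH mcoeffZ coefZ mcoeffCM; congr (_ * _ + _).
rewrite muniE msuppX big_seq1 mcoeffX eqxx scale1r coefZ coefXn mcoeffX.
have [e|ne] := eqVneq m' (mnmwiden m + U_(ord_max) *+ k)%MM.
  have -> : m' ord_max = k.
    by rewrite e mnmDE mnmwiden_ordmax mulmnE mnm1E eqxx mul1n.
  rewrite eqxx mulr1 mcoeffX (_ : [multinom _ | i < n] = m) ?eqxx //.
  apply/mnmP => i; rewrite mnmE e mnmDE mnmwiden_widen mulmnE mnm1E.
  by rewrite ord_max_neq_widen mul0n addn0.
case: eqP => [kE|_]; last by rewrite mulr0 mcoeff0.
rewrite mulr1 mcoeffX; case: eqP => [mE|//].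
by case/eqP: ne; rewrite [LHS]mnm_split mE kE.
Qed.

End LastVariable.

Lemma muni_mwiden (R : comNzRingType) n (c : {mpoly R[n]}) :
  muni (mwiden c) = c%:P.
Proof.
elim/mpolyind: c => [|c m p _ _ IH]; first by rewrite mwiden0 muni0.
rewrite mwidenD muniD IH mwidenZ muniZ mwidenX polyCD; congr (_ + _).
rewrite muniE msuppX big_seq1 mcoeffX eqxx scale1r mnmwiden_ordmax expr0.
rewrite -mul_polyC mul_polyC -mul_mpolyC polyCM alg_polyC mul_polyC.
congr (_ *: _%:P).
by congr ('X_[_]); apply/mnmP => i; rewrite mnmE mnmwiden_widen.
Qed.

Lemma mpoly_of_polyK (R : comNzRingType) n (q : {poly {mpoly R[n]}}) :
  muni (mpoly_of_poly q) = q.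
Proof.
elim/poly_ind: q => [|q c IH]; first by rewrite -{1}(muni0 n R) muniK muni0.
rewrite mpoly_of_polyD mpoly_of_polyM mpoly_of_polyX mpoly_of_polyC.
rewrite muniD muniM IH muni_mwiden; congr (_ * _ + _).
apply/polyP => k; apply/mpolyP => m; rewrite coef_muni mcoeffX coefX.
have [->|k1] := eqVneq k 1%N.
  rewrite mcoeff1 mulm1n -{1}[U_(ord_max)%MM]add0m eqm_add2r -(mnmwiden0 n).
  by rewrite (inj_eq (@inj_mnmwiden n)) eq_sym.
rewrite mcoeff0; case: eqP => // /(congr1 (fun m : 'X_{1..n.+1} => m ord_max)).
rewrite mnmDE mnmwiden_ordmax mulmnE mnm1E eqxx mul1n => e.
by move: k1; rewrite -[k]add0n -e.
Qed.

(** * Homogeneous components *)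

Lemma mdeg_mnmwiden n (m : 'X_{1..n}) : mdeg (mnmwiden m) = mdeg m.
Proof.
rewrite !mdegE big_ord_recr /= mnmwiden_ordmax addn0.
by apply: eq_bigr => i _; rewrite mnmwiden_widen.
Qed.

Lemma pihomog_mwiden (R : comNzRingType) n d (p : {mpoly R[n]}) :
  mwiden (pihomog mdeg d p) = pihomog mdeg d (mwiden p).
Proof.
elim/mpolyind: p => [|c m p _ _ IH]; first by rewrite mwiden0 !pihomog0 mwiden0.
rewrite pihomogD !mwidenD pihomogD IH; congr (_ + _).
rewrite mwidenZ mwidenX !linearZ /= mwidenZ; congr (_ *: _).
rewrite !pihomogX; have := mdeg_mnmwiden m; rewrite /= => ->.
by case: ifP; rewrite ?mwidenX ?mwiden0.
Qed.

Lemma dhomog0_const (R : comNzRingType) n (p : {mpoly R[n]}) :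
  p \is 0.-homog -> p = (p@_0%MM)%:MP.
Proof.
move=> ph; apply: msize1_polyC; rewrite msizeE.
by apply/bigmax_leqP_seq => m /(dhomog_mf ph) /= ->.
Qed.

Lemma pihomogM_dhomog (R : comNzRingType) n d e (s q : {mpoly R[n]}) :
  s \is e.-homog ->
  pihomog mdeg d (s * q) = if (e <= d)%N then s * pihomog mdeg (d - e) q else 0.
Proof.
move=> sh.
have [K qE] : exists K, q = \sum_(k < K) pihomog mdeg k q.
  by exists (mmeasure mdeg q); exact: pihomog_partitionE.
rewrite {1}qE mulr_sumr raddf_sum /=.
have H (k : 'I_K) : pihomog mdeg d (s * pihomog mdeg k q) =
  if (e + k == d)%N then s * pihomog mdeg k q else 0.
  have sk := dhomogM sh (pihomogP mdeg k q).
  case: eqP => [<-|/eqP ne]; first exact: pihomog_dE.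
  exact: pihomog_ne0 ne sk.
rewrite (eq_bigr _ (fun k _ => H k)) -big_mkcond /=.
case: leqP => ed; last first.
  by rewrite big1 // => k /eqP kE; move: ed; rewrite -kE ltnNge leq_addr.
rewrite -mulr_sumr [in RHS]qE raddf_sum /= big_mkcond /=; congr (_ * _).
apply: eq_bigr => k _; have := pihomogP mdeg k q.
have -> : (e + k == d)%N = (k == d - e :> nat)%N.
  by rewrite -{1}(subnKC ed) eqn_add2l.
case: eqP => [<-|/eqP ne] h; first by rewrite pihomog_id.
by rewrite (pihomog_ne0 ne h).
Qed.

(** * A projective Nullstellensatz *)

(** Extends map_resultant to polynomials over an arbitrary ring, such as the
    ring of polynomials in the other variables. *)
Lemma map_resultant_rmorph (aR rR : nzRingType) (f : {rmorphism aR -> rR})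
    (p q : {poly aR}) :
  f (lead_coef p) != 0 -> f (lead_coef q) != 0 ->
  f (resultant p q) = resultant (map_poly f p) (map_poly f q).
Proof.
move=> p0 q0; rewrite /resultant /Sylvester_mx !size_map_poly_id0 //.
rewrite -det_map_mx map_col_mx; congr (\det (col_mx _ _));
  by apply: map_lin1_mx => v; rewrite map_poly_rV rmorphM /= map_rVpoly.
Qed.

Record homog_ideal (R : nzRingType) n (I : {mpoly R[n]} -> Prop) : Prop :=
  HomogIdeal {
    homog_idealD : forall p q, I p -> I q -> I (p + q);
    homog_idealM : forall p q, I q -> I (p * q);
    homog_ideal_pi : forall d p, I p -> I (pihomog mdeg d p)
  }.

Definition zero_free (R : nzRingType) n (I : {mpoly R[n]} -> Prop) :=
  forall v : 'I_n -> R, (exists i, v i != 0) -> exists2 f, I f & f.@[v] != 0.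

Section Radical.
Variables (A : comNzRingType) (I : A -> Prop).
Hypotheses (ID : forall p q, I p -> I q -> I (p + q)).
Hypotheses (IM : forall p q, I q -> I (p * q)).

Definition radical p := exists k, I (p ^+ k).

Lemma radical_le k l p : (k <= l)%N -> I (p ^+ k) -> I (p ^+ l).
Proof. by move=> kl Ip; rewrite -(subnK kl) exprD; exact: IM. Qed.

Lemma radicalD p q : radical p -> radical q -> radical (p + q).
Proof.
move=> [k Ip] [l Iq]; exists (k + l)%N; rewrite exprDn.
apply: big_ind => [||i _].
- by rewrite -(mul0r (p ^+ k)); exact: IM.
- exact: ID.
rewrite -mulr_natl; apply: IM.
have [li|il] := leqP l i; first exact/IM/radical_le/Iq.
by rewrite mulrC; apply/IM/radical_le/Ip; rewrite -addnBA ?leq_addr // ltnW.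
Qed.

Lemma radicalM p q : radical q -> radical (p * q).
Proof. by move=> [k Iq]; exists k; rewrite exprMn; exact: IM. Qed.

End Radical.

Section Elimination.
Variables (C : closedFieldType) (n : nat) (I : {mpoly C[n.+1]} -> Prop).
Hypotheses (I_ideal : homog_ideal I) (I_zero_free : zero_free I).

Local Notation widen := (widen_ord (leqnSn n)).

(** Since the last coordinate point is not a common zero, some homogeneous
    element of I is monic in the last variable, up to a scalar.  No change of
    coordinates is involved.  The degree can be made positive by
    multiplication by this variable. *)
Lemma exists_monic : exists d g,
  [/\ I g, g \is d.-homog, (0 < d)%N & g@_(U_(ord_max) *+ d) != 0].
Proof.
pose v : 'I_n.+1 -> C := extend_point (fun=> 0) 1.
have vmax : v ord_max = 1 by exact: extend_point_max.
have [|f If fv] := I_zero_free (v := v).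
  by exists ord_max; rewrite vmax oner_neq0.
have [k fkv] : exists k, (pihomog mdeg k f).@[v] != 0.
  have fE := pihomog_partitionE (leqnn (mmeasure mdeg f)).
  have /existsP[k kP] : [exists k : 'I_(mmeasure mdeg f),
      (pihomog mdeg k f).@[v] != 0].
    apply: contraNT fv; rewrite negb_exists => /forallP f0.
    rewrite fE raddf_sum /= big1 // => k _; apply/eqP.
    by have := f0 k; rewrite negbK.
  by exists k.
pose g := 'X_ord_max * pihomog mdeg k f.
have gv : g.@[v] != 0 by rewrite mevalM mevalXU vmax mul1r.
have gh : g \is k.+1.-homog.
  by apply: (dhomogM (d := 1%N)); rewrite ?pihomogP // dhomogX /= mdeg1.
exists k.+1, g; split=> //.
  by apply: (homog_idealM I_ideal); exact: homog_ideal_pi.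
have /hasP[m mg mv] :
    has (fun m : 'X_{1..n.+1} => \prod_i v i ^+ m i != 0) (msupp g).
  apply: contraNT gv => /hasPn g0; rewrite mevalE big_seq big1 // => m mg.
  by have := g0 m mg; rewrite negbK => /eqP ->; rewrite mulr0.
rewrite -mcoeff_msupp (_ : (_ *+ _)%MM = m) //.
have mE : m = (U_(ord_max) *+ m ord_max)%MM.
  apply/mnmP => i; rewrite mulmnE mnm1E.
  case: eqP => [<-|/eqP ne]; first by rewrite mul1n.
  move/prodf_neq0: mv => /(_ i isT).
  have [j ->|/eqP] := unliftP ord_max i; last by rewrite eq_sym (negPf ne).
  rewrite /v /extend_point liftK expr0n.
  by case: (m _ =P 0%N) => [-> //|_]; rewrite eqxx.
have := dhomog_mf gh mg; rewrite {1}mE => /=.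
by rewrite mdegMn mdeg1 mul1n => e; rewrite -e -mE.
Qed.

(** Elimination theory: if a nonzero point a had no element of the elimination
    ideal that is nonzero at a, then I would have a zero above a.  The
    polynomials f(a, t), for f in I, form an ideal J of C[t] without zeros,
    so J contains a nonzero constant.  With f in I giving this constant and
    g in I monic in t, the resultant of g and f + t^k g lies in the
    elimination ideal, and does not vanish at a. *)
Lemma elimination_zero_free : zero_free (fun c => I (mwiden c)).
Proof.
move=> a [i0 ai0].
have [ID IM Ipi] := I_ideal.
have [d [g [Ig gh d_gt0 gd]]] := exists_monic.
pose G := muni g; pose c0 := g@_(U_(ord_max) *+ d).
have Gcoef k m : G`_k@_m = if (mdeg m + k == d)%N
    then g@_(mnmwiden m + U_(ord_max) *+ k)%MM else 0.
  rewrite coef_muni; case: eqP => // /eqP ne.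
  apply: dhomog_nemf_coeff gh _.
  rewrite /= mdegD mdegMn mdeg1 mul1n.
  by have := mdeg_mnmwiden m; rewrite /= => ->.
have Gd : G`_d = c0%:MP.
  apply/mpolyP => m; rewrite Gcoef mcoeffC.
  have -> : (mdeg m + d == d)%N = (m == 0%MM).
    by rewrite -[X in _ == X]add0n eqn_add2r mdeg_eq0.
  case: eqP => [->|]; rewrite ?eqxx ?mulr1 //.
    by rewrite mnmwiden0 add0m.
  by rewrite mulr0.
have sG : size G = d.+1.
  apply/eqP; rewrite eqn_leq; apply/andP; split; last first.
    by rewrite ltnNge; apply: contra gd => /leq_sizeP/(_ d (leqnn d));
       rewrite Gd => /eqP; rewrite mpolyC_eq0.
  apply/leq_sizeP => k dk; apply/mpolyP => m; rewrite Gcoef mcoeff0.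
  by case: eqP => // e; move: dk; rewrite -e ltnNge leq_addl.
have lG : lead_coef G = c0%:MP by rewrite lead_coefE sG.
pose J (h : {poly C}) := exists2 f, I f & map_poly (meval a) (muni f) = h.
have JD h1 h2 : J h1 -> J h2 -> J (h1 + h2).
  move=> [f1 If1 <-] [f2 If2 <-]; exists (f1 + f2); first exact: ID.
  by rewrite muniD rmorphD.
have JM h1 h2 : J h2 -> J (h1 * h2).
  move=> [f2 If2 <-]; exists (mpoly_of_poly (map_poly (@mpolyC n C) h1) * f2).
    exact: IM.
  rewrite muniM mpoly_of_polyK rmorphM /=; congr (_ * _).
  rewrite -map_poly_comp map_poly_id // => x _ /=; exact: mevalC.
have JG : J (map_poly (meval a) G) by exists g.
have c0a : (lead_coef G).@[a] != 0 by rewrite lG mevalC.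
have Ga0 : map_poly (meval a) G != 0.
  by rewrite -size_poly_eq0 size_map_poly_id0 // sG.
(* Bezout relations lower the degree of an element of J that has a root. *)
have [c c_neq0 [f If fE]] : exists2 c, c != 0 & J c%:P.
  move: {2}(size _) JG Ga0 (leqnn (size (map_poly (meval a) G))) => k.
  elim: k (map_poly _ _) => [|k IH] h Jh h0 hk.
    by move: hk; rewrite leqn0 size_poly_eq0 (negPf h0).
  have [/size_poly1P[c c0' hE]|/closed_rootP[x hx]] := boolP (size h == 1%N).
    by exists c; rewrite // -hE.
  have [|f If fx] := I_zero_free (v := extend_point a x).
    by exists (widen i0); rewrite extend_point_widen.
  pose fa := map_poly (meval a) (muni f).
  have Jf : J fa by exists f.
  rewrite meval_muni -/fa in fx.
  have [u uE] := Bezoutp h fa.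
  have g0 : gcdp h fa != 0 by rewrite gcdp_eq0 negb_and h0.
  apply: (IH (u.1 * h + u.2 * fa)).
  - by apply: JD; apply: JM.
  - by rewrite -size_poly_eq0 (eqp_size uE) size_poly_eq0.
  rewrite -ltnS (eqp_size uE); apply: leq_trans hk.
  rewrite ltn_neqAle dvdp_leq ?dvdp_gcdl // andbT.
  apply: contra fx => e.
  move: (dvdp_gcdl h fa) => /dvdp_size_eqp; rewrite e => /esym ge.
  rewrite -/(root fa x); move: hx.
  rewrite !root_factor_theorem => hx; apply: dvdp_trans hx _.
  by rewrite -(eqp_dvdl _ ge) dvdp_gcdr.
(* The leading coefficient of f in t could vanish at a, unlike that of
   f + t^k g, whose resultant therefore commutes with evaluation at a. *)
pose k := size (muni f).
pose F := muni f + 'X^k * G.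
have G0 : G != 0 by rewrite -lead_coef_eq0 lG mpolyC_eq0.
have sXG : size ('X^k * G) = (k + d.+1)%N.
  by rewrite mulrC (size_mulXn k G0); congr (_ + _)%N.
have skG : (size (muni f) < size ('X^k * G)%R)%N.
  by rewrite sXG addnS ltnS leq_addr.
have lF : lead_coef F = c0%:MP.
  by rewrite /F lead_coefDr // lead_coefM lead_coefXn mul1r lG.
have sF : (1 < size F)%N.
  by rewrite /F addrC size_polyDl // sXG addnS ltnS ltn_addl.
have [|//|uv _ rE] := @resultant_in_ideal _ G F; first by rewrite sG.
exists (resultant G F).
  rewrite -mpoly_of_polyC rE mpoly_of_polyD !mpoly_of_polyM.
  apply: (ID _ _); apply: (IM _ _); first by rewrite (muniK g).
  have -> : mpoly_of_poly F = f + mpoly_of_poly 'X^k * g.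
    rewrite /F mpoly_of_polyD mpoly_of_polyM.
    by congr (_ + _ * _); exact: muniK.
  exact: ID If (IM _ _ Ig).
rewrite map_resultant_rmorph //; last by rewrite lF /= mevalC.
rewrite resultant_eq0 -leqNgt.
suff : map_poly (meval a) G %| map_poly (meval a) F - c%:P.
  move=> GFc.
  have : gcdp (map_poly (meval a) G) (map_poly (meval a) F) %| c%:P.
    rewrite -[c%:P](subKr (map_poly (meval a) F)) dvdp_subr ?dvdp_gcdr //.
    exact: dvdp_trans (dvdp_gcdl _ _) GFc.
  by move=> /dvdp_leq; rewrite polyC_eq0 size_polyC c_neq0; apply.
have -> : map_poly (meval a) F =
    c%:P + map_poly (meval a) 'X^k * map_poly (meval a) G.
  by rewrite -fE -rmorphM -rmorphD.
by rewrite addrC addKr dvdp_mull.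
Qed.

End Elimination.

(** By induction on the number of variables, the elimination ideal contains
    powers of all variables but the last.  An element of I that is monic in the
    last variable then expresses a power of it through the other variables. *)
Lemma projective_nullstellensatz (C : closedFieldType) n
    (I : {mpoly C[n]} -> Prop) :
  homog_ideal I -> zero_free I -> forall i, exists N, I ('X_i ^+ N).
Proof.
elim: n I => [|n IH] I I_ideal I_zf i; first by case: i.
have [ID IM Ipi] := I_ideal.
have widen_in j : exists N, I ('X_(widen_ord (leqnSn n) j) ^+ N).
  have [|N IN] := IH (fun c => I (mwiden c)) _
    (elimination_zero_free I_ideal I_zf) j.
    split=> [p q|p q|d p]; rewrite ?mwidenD ?mwidenM ?pihomog_mwiden.
    - exact: ID.
    - exact: IM.
    - exact: Ipi.
  by exists N; move: IN; rewrite rmorphXn /= mwidenX mnmwiden1.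
have [d [g [Ig gh d_gt0 gd]]] := exists_monic I_ideal I_zf.
have [j ->|->] := unliftP ord_max i.
  by rewrite lift_ord_max; exact: widen_in.
suff [N IN] : radical I ('X_ord_max ^+ d) by exists (d * N)%N; rewrite exprM.
have radicalI := radicalD ID IM; have radicalIM := radicalM IM.
pose c := g@_(U_(ord_max) *+ d).
have -> : 'X_ord_max ^+ d = c^-1 *: g +
    \sum_(m <- rem (U_(ord_max) *+ d)%MM (msupp g))
      (- (c^-1 * g@_m))%:MP * 'X_[m].
  rewrite [X in c^-1 *: X](mpolyE g) (big_rem (U_(ord_max) *+ d)%MM) /=;
    last by rewrite mcoeff_msupp.
  rewrite scalerDr scalerA mulVf // scale1r mpolyXn -addrA scaler_sumr.
  rewrite -big_split /= big1 ?addr0 // => m _.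
  by rewrite mul_mpolyC scalerA scaleNr subrr.
apply: (radicalI _ _).
  by exists 1%N; rewrite expr1 -mul_mpolyC; apply: IM.
rewrite big_seq; apply: big_ind => [||m].
- by exists 1%N; rewrite expr1 -(mul0r g); apply: IM.
- exact: radicalI.
 rewrite (mem_rem_uniq _ (msupp_uniq _)) inE => /andP[mU mg].
apply: (radicalIM _ _).
have [j mj] : exists j : 'I_n, m (widen_ord (leqnSn n) j) != 0%N.
  apply/existsP; apply: contraNT mU; rewrite negb_exists => /forallP m0.
  have e : m = (U_(ord_max) *+ m ord_max)%MM.
    have m_widen0 : [multinom m (widen_ord (leqnSn n) j) | j < n] = 0%MM.
      apply/mnmP => j; rewrite mnmE mnm0E.
      by apply/eqP; have := m0 j; case: eqP.
    by rewrite [LHS]mnm_split m_widen0 mnmwiden0 add0m.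
  have := dhomog_mf gh mg; rewrite {1}e /= mdegMn mdeg1 mul1n => <-.
  by rewrite -e.
rewrite -(@submK _ U_(widen_ord (leqnSn n) j)%MM m) ?mpolyXD.
  exact/radicalIM/widen_in.
apply/mnm_lepP => k; rewrite mnm1E; case: eqP => [<-|//].
by rewrite lt0n.
Qed.

Definition ideal_closed (A : comNzRingType) (K : A -> Prop) :=
  (forall p q, K p -> K q -> K (p + q)) /\ (forall p q, K q -> K (p * q)).

(** The exponent N depends on the equations S only, so that one power of the
    variables serves for every ideal K that contains S.  It is found with K the
    ideal generated by S, described as an intersection. *)
Lemma powers_in_ideal (C : closedFieldType) n (S : {mpoly C[n]} -> Prop) :
    (forall s, S s -> exists e, s \is e.-homog) -> zero_free S ->
  exists N, forall K, ideal_closed K -> (forall s, S s -> K s) ->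
    forall i, K ('X_i ^+ N).
Proof.
move=> S_homog S_zf.
pose I p := forall K, ideal_closed K -> (forall s, S s -> K s) -> K p.
have I_ideal : homog_ideal I.
  split=> [p q Ip Iq K KI SK|p q Iq K KI SK|d p Ip K [KD KM] SK].
  - by apply: KI.1; [exact: Ip | exact: Iq].
  - by apply: KI.2; exact: Iq.
  (* The elements of K all of whose homogeneous components lie in K form an
     ideal. *)
  apply: (Ip (fun q => forall d, K (pihomog mdeg d q))); last first.
    move=> s Ss e; have [e' sh] := S_homog s Ss.
    have [<-|ne] := eqVneq e' e; first by rewrite pihomog_dE //; exact: SK.
    by rewrite (pihomog_ne0 ne sh) -(mul0r s); apply/KM/SK.
  split=> [q r Kq Kr e|q r Kr e]; first by rewrite pihomogD; exact: KD.
  rewrite (pihomog_partitionE (leqnn (mmeasure mdeg q))) mulr_suml raddf_sum /=.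
  have K0 : K 0 by rewrite -(mul0r (pihomog mdeg 0 r)); exact: KM.
  apply: big_ind => // k _.
  rewrite (pihomogM_dhomog _ _ (pihomogP _ _ _)).
  by case: ifP => // _; exact: KM.
have I_zf : zero_free I.
  by move=> v /S_zf[f Sf fv]; exists f => // K _ SK; exact: SK.
have [N IN] := fin_all_exists (projective_nullstellensatz I_ideal I_zf).
exists (\max_i N i)%N => K KI SK i.
by apply: (radical_le KI.2 (leq_bigmax i)); exact: IN.
Qed.

(** * Division by the differential and logarithmic forms *)

Section Equations.
Variables (C : fieldType) (n : nat).
Implicit Types (p q s : {mpoly C[n]}).

Definition singular_eqs p s := s = p \/ exists i, s = p^`M(i).

Definition tangency_eqs p q s :=
  [\/ s = p, s = q | exists i j, s = p^`M(i) * q^`M(j) - p^`M(j) * q^`M(i)].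

Lemma dhomog_mderiv i d p : p \is d.-homog -> p^`M(i) \is d.-1.-homog.
Proof.
move=> ph; apply/dhomogP => m; rewrite mcoeff_msupp mcoeff_deriv => pm.
have /(dhomog_mf ph) /= <- : (m + U_(i))%MM \in msupp p.
  by rewrite mcoeff_msupp; apply: contra_neq pm => ->; rewrite mul0rn.
by rewrite mdegD mdeg1 addn1.
Qed.

Lemma singular_eqs_homog d p s : p \is d.-homog ->
  singular_eqs p s -> exists e, s \is e.-homog.
Proof.
by move=> ph [->|[i ->]]; [exists d | exists d.-1; apply: dhomog_mderiv].
Qed.

Lemma tangency_eqs_homog d p q s : p \is d.-homog -> q \is d.-homog ->
  tangency_eqs p q s -> exists e, s \is e.-homog.
Proof.
move=> ph qh [->|->|[i [j ->]]]; [by exists d | by exists d |].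
by exists (d.-1 + d.-1)%N; apply: rpredB; apply: dhomogM; apply: dhomog_mderiv.
Qed.

End Equations.

Section Smooth.
Variables (C : numClosedFieldType) (n : nat).
Hypothesis n_ge3 : (3 <= n)%N.
Implicit Types (p q f u : {mpoly C[n]}) (a : 'I_n -> {mpoly C[n]}).

Let i0 : 'I_n := Ordinal (ltn_trans (isT : 0 < 2)%N n_ge3).
Let i1 : 'I_n := Ordinal (ltn_trans (isT : 1 < 2)%N n_ge3).
Let i2 : 'I_n := Ordinal n_ge3.

Lemma ideal_colon (P : {mpoly C[n]} -> Prop) u :
  ideal_closed P -> ideal_closed (fun w => P (u * w)).
Proof.
move=> [PD PM]; split=> [p q|p q]; first by rewrite mulrDr; exact: PD.
by rewrite mulrCA; exact: PM.
Qed.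

Lemma divides_closed p : ideal_closed (divides p).
Proof. by split=> [q r|q r]; [exact: divides_add | exact: divides_mull]. Qed.

Lemma in_ideal2_closed p q : ideal_closed (in_ideal2 p q).
Proof.
split=> [u v [a [b ->]] [c [d ->]]|u v [a [b ->]]].
  by exists (a + c), (b + d); ring.
by exists (u * a), (u * b); ring.
Qed.

Lemma divides_of_ideal S p u : p != 0 ->
    (forall s, S s -> exists e, s \is e.-homog) -> zero_free S ->
  (forall s, S s -> divides p (u * s)) -> divides p u.
Proof.
move=> p0 Sh Szf Su; have [N NP] := powers_in_ideal Sh Szf.
have xu i : divides p ('X_i ^+ N * u).
  by rewrite mulrC; exact: (NP _ (ideal_colon u (divides_closed p)) Su).
apply: (divides_of_mul (varX_neq0 C N i0) _ p0 (xu i0) (xu i1)).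
exact: koszul2_var.
Qed.

Section Division.
Variables (d : nat) (p : {mpoly C[n]}).
Hypotheses (p0 : p != 0) (p_homog : p \is d.-homog).
Hypothesis p_smooth : zero_free (singular_eqs p).

Let p_eqs s := @singular_eqs_homog C n d p s p_homog.

Lemma divides_of_mderiv u :
  (forall i, divides p (u * p^`M(i))) -> divides p u.
Proof.
move=> pu; apply: (divides_of_ideal p0 p_eqs p_smooth).
by move=> s [->|[i ->]]; [apply/divides_mull/divides_refl | exact: pu].
Qed.

(** The polynomials w for which w a is, modulo p, a multiple f dp of dp form an
    ideal that contains p and each derivative of p (with f = a_j for the j-th
    one), hence some power of each variable.  The resulting multipliers f0, f1,
    f2 agree as fractions, because dp can be cancelled modulo p; divides_lift
    glues them. *)
Lemma division_mod a :
    (forall i j, divides p (a i * p^`M(j) - a j * p^`M(i))) ->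
  exists f, forall i, divides p (a i - f * p^`M(i)).
Proof.
move=> inv; have [N NP] := powers_in_ideal p_eqs p_smooth.
have lift k : exists f, forall i, divides p (f * p^`M(i) - 'X_k ^+ N * a i).
  apply: (NP (fun w => exists f, forall i, divides p (f * p^`M(i) - w * a i))).
    split=> [v w [f fP] [g gP]|v w [f fP]].
      exists (f + g) => i.
      by have := divides_add (fP i) (gP i); congr (divides p _); ring.
    exists (v * f) => i.
    by have := divides_mull v (fP i); congr (divides p _); ring.
  move=> s [->|[j ->]]; first by exists 0 => i; exists (- a i); ring.
  by exists (a j) => i; have := inv j i; congr (divides p _); ring.
have [f0 f0P] := lift i0; have [f1 f1P] := lift i1; have [f2 f2P] := lift i2.
have comm x y f g : (forall i, divides p (f * p^`M(i) - x * a i)) ->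
    (forall i, divides p (g * p^`M(i) - y * a i)) -> divides p (x * g - y * f).
  move=> fP gP; apply: divides_of_mderiv => i.
  have := divides_sub (divides_mull x (gP i)) (divides_mull y (fP i)).
  by congr (divides p _); ring.
have xy := @koszul2_var C n N i0 i1 isT.
have x0 := varX_neq0 C N i0; have y0 := varX_neq0 C N i1.
have [f [h0 h1 _]] := divides_lift y0 xy
  (@koszul3_var C n N i0 i1 i2 isT isT isT) p0
  (comm _ _ _ _ f0P f1P) (comm _ _ _ _ f1P f2P) (comm _ _ _ _ f2P f0P).
exists f => i; apply: (divides_of_mul x0 xy p0).
  have := divides_sub (divides_mulr p^`M(i) h0) (f0P i).
  by congr (divides p _); ring.
have := divides_sub (divides_mulr p^`M(i) h1) (f1P i).
by congr (divides p _); ring.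
Qed.

End Division.

(** Two divisions, by dp and then by dq, give
    a = v q dp + g p dq + p q b, and the component of degree 2 d - 1 retains
    the constant terms of v and g only. *)
Lemma logarithmic_form d p q a : (0 < d)%N -> p != 0 -> q != 0 ->
    p \is d.-homog -> q \is d.-homog ->
    zero_free (singular_eqs p) -> zero_free (singular_eqs q) ->
    zero_free (tangency_eqs p q) ->
    (forall i, a i \is (2 * d - 1).-homog) ->
    (forall i j, divides p (a i * p^`M(j) - a j * p^`M(i))) ->
    (forall i j, divides q (a i * q^`M(j) - a j * q^`M(i))) ->
  exists c e : C, forall i, a i = c%:MP * (q * p^`M(i)) + e%:MP * (p * q^`M(i)).
Proof.
move=> d0 p0 q0 ph qh p_smooth q_smooth pq_transv ah p_inv q_inv.
have pq_homog s := @tangency_eqs_homog _ _ d p q s ph qh.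
have q_cancel u : divides q (u * p) -> divides q u.
  apply: (divides_cancel_transverse q0 (divides_of_mderiv q0 qh q_smooth)).
  move=> v vp vm; apply: (divides_of_ideal q0 pq_homog pq_transv).
  move=> s [->//|->|[i [j ->]]]; first exact/divides_mull/divides_refl.
  by have := vm j i; congr (divides q _); ring.
have [f fP] := division_mod p0 ph p_smooth p_inv.
(* Modulo p, a /\ dq = f dp /\ dq, and it vanishes modulo q: f times each
   minor of (dp, dq) lies in (p, q). *)
have [v [w fE]] : in_ideal2 q p f.
  have [N NP] := powers_in_ideal pq_homog pq_transv.
  have xf : forall k, in_ideal2 p q (f * 'X_k ^+ N).
    apply: (NP _ (ideal_colon f (in_ideal2_closed p q))) => s.
    move=> [->|->|[i [j ->]]].
    - by exists f, 0; ring.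
    - by exists 0, f; ring.
    have [b bE] := fP i; have [c cE] := fP j; have [e eE] := q_inv i j.
    exists (c * q^`M(i) - b * q^`M(j)), e.
    have -> : e * q = a i * q^`M(j) - a j * q^`M(i) by rewrite eE mulrC.
    have -> : a i = p * b + f * p^`M(i) by rewrite -bE; ring.
    have -> : a j = p * c + f * p^`M(j) by rewrite -cE; ring.
    by ring.
  have [v [w fE]] : in_ideal2 p q f.
    apply: (in_ideal2_of_mul (varX_neq0 C N i0) (varX_neq0 C N i1)
      (@koszul2_var C n N i0 i1 isT)
      (@koszul3_var C n N i0 i1 i2 isT isT isT) q0 q_cancel);
    by rewrite mulrC; exact: xf.
  by exists w, v; rewrite fE addrC.
have al_ex i : exists b, a i = v * (q * p^`M(i)) + p * b.
  have [b bE] := fP i; exists (b + w * p^`M(i)).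
  rewrite mulrDr -bE fE; ring.
have [al alE] := fin_all_exists al_ex.
have [g gP] : exists g, forall i, divides q (al i - g * q^`M(i)).
  apply: (division_mod q0 qh q_smooth) => i j; apply: q_cancel.
  have := divides_sub (q_inv i j)
    (ex_intro _ _ (erefl (q * (v * (p^`M(i) * q^`M(j) - p^`M(j) * q^`M(i)))))).
  by rewrite !alE; congr (divides q _); ring.
exists (pihomog mdeg 0 v)@_0%MM, (pihomog mdeg 0 g)@_0%MM => i.
have constE u : ((pihomog mdeg 0 u)@_0%MM)%:MP = pihomog mdeg 0 u.
  exact/esym/dhomog0_const/pihomogP.
have dE : (d + d.-1 = 2 * d - 1)%N by lia.
have [b bE] := gP i.
have aE : a i = q * p^`M(i) * v + p * q^`M(i) * g + p * q * b.
  by rewrite alE (_ : al i = q * b + g * q^`M(i)); [ring | rewrite -bE; ring].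
rewrite -(pihomog_dE (ah i)) aE !pihomogD.
rewrite (pihomogM_dhomog _ _ (dhomogM qh (dhomog_mderiv i ph))).
rewrite (pihomogM_dhomog _ _ (dhomogM ph (dhomog_mderiv i qh))).
rewrite (pihomogM_dhomog _ _ (dhomogM ph qh)) -dE leqnn subnn.
rewrite ifF ?addr0 ?constE; first by rewrite ![_ * pihomog _ _ _]mulrC.
by apply/negbTE; rewrite -ltnNge ltn_add2l prednK.
Qed.

End Smooth.

(** * Geometric hypotheses and rational forms *)

Section Geometry.
Variables (C : fieldType) (m : nat).
Implicit Types (p q : {mpoly C[m]}) (v : 'I_m -> C).

Lemma eval_form_neq0 (w : form1 C m) v :
  eval_form w (\row_i v i) != 0 -> exists j, (w 0 j).@[v] != 0.
Proof.
case/rV0Pn => j; rewrite mxE => wj; exists j.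
by rewrite (meval_eq _ (v2 := (\row_i v i) 0)) // => i; rewrite mxE.
Qed.

Lemma on_hypersurface_row p v : (exists i, v i != 0) -> p.@[v] = 0 ->
  on_hypersurface p (\row_i v i).
Proof.
move=> [i vi] pv; split; first by apply/rV0Pn; exists i; rewrite mxE.
by rewrite -pv; apply: meval_eq => k; rewrite mxE.
Qed.

Lemma smooth_zero_free p :
  smooth_hypersurface p -> zero_free (singular_eqs p).
Proof.
move=> ps v v0; have [pv|pv] := eqVneq p.@[v] 0; last by exists p => //; left.
have [j] := eval_form_neq0 (ps _ (on_hypersurface_row v0 pv)).
by rewrite mxE => pj; exists p^`M(j) => //; right; exists j.
Qed.

(** If all minors of (dp, dq) vanished at a common zero, dq would be a multiple
    of dp there, so both tangent spaces would lie in the kernel of dq; being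
    transverse, they span everything, and dq would vanish. *)
Lemma transverse_zero_free p q : general_projective_position p q ->
  zero_free (tangency_eqs p q).
Proof.
move=> [ps qs pq] v v0.
have [pv|pv] := eqVneq p.@[v] 0; last by exists p => //; constructor 1.
have [qv|qv] := eqVneq q.@[v] 0; last by exists q => //; constructor 2.
have pz := on_hypersurface_row v0 pv; have qz := on_hypersurface_row v0 qv.
have /existsP[i /existsP[j ij]] : [exists i, [exists j,
    (p^`M(i) * q^`M(j) - p^`M(j) * q^`M(i)).@[v] != 0]]; last first.
  by eexists; last exact: ij; constructor 3; exists i, j.
have [k] := eval_form_neq0 (ps _ pz); rewrite mxE => pk.
apply: contraNT (qs _ qz); rewrite negb_exists => /forallP minors0.
have minor0 i j : p^`M(i).@[v] * q^`M(j).@[v] = p^`M(j).@[v] * q^`M(i).@[v].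
  have := minors0 i; rewrite negb_exists => /forallP/(_ j).
  by rewrite negbK mevalB !mevalM subr_eq0 => /eqP.
have dpE (w : {mpoly C[m]}) j :
    eval_form (dform w) (\row_i v i) 0 j = w^`M(j).@[v].
  by rewrite !mxE; apply: meval_eq => i; rewrite mxE.
have dqE : eval_form (dform q) (\row_i v i) =
    (q^`M(k).@[v] / p^`M(k).@[v]) *: eval_form (dform p) (\row_i v i).
  apply/rowP => j; rewrite [RHS]mxE !dpE; apply: (mulfI pk).
  by rewrite minor0; field.
have : (1%:M <= lifted_tangent q (\row_i v i))%MS.
  apply: submx_trans (_ : _ <= lifted_tangent p _ + lifted_tangent q _)%MS _.
    by rewrite sub1mx; exact: (pq _ pz qz).
  rewrite addsmx_sub submx_refl andbT; apply/sub_kermxP.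
  by rewrite dqE linearZ /= -scalemxAr mulmx_ker scaler0.
by move/sub_kermxP; rewrite mul1mx => /(congr1 trmx); rewrite trmxK trmx0 => ->.
Qed.

Lemma invariant_byP p (w : form1 C m) : invariant_by p w ->
  forall i j, divides p (w 0 i * p^`M(j) - w 0 j * p^`M(i)).
Proof.
move=> [theta /matrixP e] i j; exists (theta i j).
by have := e i j; rewrite !mxE.
Qed.

Lemma irreducible_dhomog_gt0 d p :
  irreducible_mpoly p -> p \is d.-homog -> (0 < d)%N.
Proof.
move=> [p0 pU _]; case: d => // ph; case/negP: pU.
have pE := dhomog0_const ph; rewrite pE rmorph_unit // unitfE.
by move: p0; rewrite pE mpolyC_eq0 mcoeffC eqxx mulr1.
Qed.

Lemma ratform_logarithmic p q (w : form1 C m) (a b : C) :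
    p != 0 -> q != 0 ->
    (forall j, w 0 j = a%:MP * (q * p^`M(j)) + b%:MP * (p * q^`M(j))) ->
  (ratpoly (p * q))^-1 *: ratform w =
    ratconst m a *: ((ratpoly p)^-1 *: ratform (dform p)) +
    ratconst m b *: ((ratpoly q)^-1 *: ratform (dform q)).
Proof.
move=> p0 q0 wE.
have log_field (K : fieldType) (x y dx dy s t : K) : x != 0 -> y != 0 ->
    (x * y)^-1 * (s * (y * dx) + t * (x * dy)) =
    s * (x^-1 * dx) + t * (y^-1 * dy).
  by move=> x0 y0; field; rewrite x0 y0.
have ratformE (u : form1 C m) j : ratform u 0 j = tofrac (u 0 j).
  by rewrite mxE.
have dformE (u : {mpoly C[m]}) j : dform u 0 j = u^`M(j) by rewrite mxE.
apply/rowP => j.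
rewrite [LHS]mxE [RHS]mxE [X in _ = X + _]mxE [X in _ = _ + X]mxE.
rewrite [X in _ = _ * X + _]mxE [X in _ = _ + _ * X]mxE !ratformE !dformE wE.
rewrite /ratpoly /ratconst tofracD !tofracM.
by apply: log_field; rewrite tofrac_eq0.
Qed.

End Geometry.

(** * Forms with two invariant hypersurfaces *)

Theorem theoremD (R : realType) (m d : nat) (P Q : {mpoly R[i][m]})
    (Omega : form1 R[i] m) :
  (3 <= m)%N ->
  reduced_mpoly P -> irreducible_mpoly P -> P \is d.-homog ->
  reduced_mpoly Q -> irreducible_mpoly Q -> Q \is d.-homog ->
  general_projective_position P Q ->
  homog_form (2 * d - 1)%N Omega ->
  invariant_by P Omega ->
  invariant_by Q Omega ->
  exists a b : R[i],
    (ratpoly (P * Q))^-1 *: ratform Omega =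
      ratconst m a *: ((ratpoly P)^-1 *: ratform (dform P)) +
      ratconst m b *: ((ratpoly Q)^-1 *: ratform (dform Q)).
Proof.
move=> m3 [P0 _] Pirr Ph [Q0 _] _ Qh PQ Oh Pinv Qinv.
have [Ps Qs _] := PQ.
have [a [b OmegaE]] := logarithmic_form m3 (irreducible_dhomog_gt0 Pirr Ph)
  P0 Q0 Ph Qh (smooth_zero_free Ps) (smooth_zero_free Qs)
  (transverse_zero_free PQ) Oh (invariant_byP Pinv) (invariant_byP Qinv).
by exists a, b; exact: ratform_logarithmic.
Qed.
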